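(* Let $p\ge1$, $E$ be a separable metrisable space and $d$ be a complete metric inducing its topology. Let $\mu\in\mathcal{P}_p(E)$ be of the form $\mu=\sum_{i=1}^n\alpha_i\delta_{x_i}$ for some $n\in\mathbb{N}$, pairwise distinct $x_1,\dots,x_n\in E$ and $\alpha\in(0,1]^n$ with $\sum_{i=1}^n\alpha_i=1$. Then $$\mathcal{W}_p(\mu,\nu)^p=\min_{\substack{\nu_1,\dots,\nu_n\in\mathcal{P}_p(E):\\ \sum_{i=1}^n\alpha_i\nu_i=\nu}}\ \sum_{i=1}^n\alpha_i\int_Ed(x,x_i)^p\,\nu_i(\mathrm{d}x)=\min_{\substack{f\in B(E,\mathbb{R}_+^n):\ \sum_{i=1}^n\alpha_if_i=1,\\ \int_Ef_1\,\mathrm{d}\nu=\cdots=\int_Ef_n\,\mathrm{d}\nu=1}}\ \int_E\sum_{i=1}^n\alpha_id(x,x_i)^pf_i(x)\,\nu(\mathrm{d}x)$$ for any $\nu\in\mathcal{P}_p(E)$. If in addition there are $m\in\mathbb{N}$, pairwise distinct $y_1,\dots,y_m\in E$ and $\beta\in(0,1]^m$ such that $\sum_{j=1}^m\beta_j=1$ and $\nu=\sum_{j=1}^m\beta_j\delta_{y_j}$, then $$\mathcal{W}_p(\mu,\nu)^p=\min_{\substack{A\in\mathbb{R}_+^{n\times m}:\\ A^\top\alpha=\mathbf{1}_m,\ A\beta=\mathbf{1}_n}}\ \sum_{i=1}^n\sum_{j=1}^m\alpha_iA_{i,j}\beta_jd(x_i,y_j)^p,$$ where $\mathbf{1}_i\in\mathbb{R}^i$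 is given by $\mathbf{1}_i:=(1,\dots,1)^\top$ for $i\in\{m,n\}$.
   Context: $\mathcal{P}_p(E)$ is the set of all Borel probability measures $\mu$ on $E$ with $\int_Ed(x,x_0)^p\,\mu(\mathrm{d}x)<\infty$ for some $x_0\in E$, endowed with the $p$th Wasserstein metric $\mathcal{W}_p(\mu,\nu):=\inf_\theta(\int_{E\times E}d(x,y)^p\,\mathrm{d}\theta(x,y))^{1/p}$, where the infimum runs over all Borel probability measures $\theta$ on $E\times E$ with first and second marginals $\mu$ and $\nu$. $\delta_x$ is the Dirac measure at $x$, $\mathbb{R}_+=[0,\infty)$, and $B(E,\mathbb{R}_+^n)$ is the set of all $\mathbb{R}_+^n$-valued Borel measurable maps $f=(f_1,\dots,f_n)$ on $E$. *)

(* Defs.v *)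
From HB Require Import structures.
From mathcomp Require Import all_boot all_order all_algebra.
From mathcomp Require Import all_classical all_reals all_analysis.

Set Implicit Arguments.
Unset Strict Implicit.
Unset Printing Implicit Defensive.

Import Order.TTheory GRing.Theory Num.Theory.
Import numFieldNormedType.Exports.

Local Open Scope classical_set_scope.
Local Open Scope ring_scope.

(* The library's [Complete] and [measurableType] both require a distinguished
   point, i.e. a nonempty carrier. *)
#[short(type="completeMetricType")]
HB.structure Definition CompleteMetric (K : numDomainType) :=
  { M of Metric K M & Complete M }.

Definition separable (T : topologicalType) : Prop :=
  exists2 D : set T, countable D & dense D.

Notation borel T := (g_sigma_algebraType (@open T)).

Definition is_min d (T : porderType d) (S : set T) (v : T) : Prop :=
  S v /\ lbound S v.

Section wasserstein.
Context {R : realType}.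

(* Measures are compared on measurable sets only: the value of a [probability]
   on other sets is unconstrained. *)
Definition is_mixture d (T : measurableType d) n (alpha : 'cV[R]_n)
    (nus : 'I_n -> probability T R) (nu : probability T R) : Prop :=
  forall A, measurable A -> nu A = (\sum_(i < n) (alpha i 0)%:E * nus i A)%E.

Context {E : completeMetricType R}.

Definition Pp (p : R) : set (probability (borel E) R) :=
  [set mu : probability (borel E) R | exists x0 : E,
    (\int[mu]_(x in [set: borel E]) (mdist (x : E) x0 `^ p)%:E < +oo)%E].

(* Couplings live on the Borel sigma-algebra of the product topology. *)
Definition couplings (mu nu : probability (borel E) R) :
    set (probability (borel (E * E)%type) R) :=
  [set theta | forall A : set (borel E), measurable A ->
    pushforward theta (fst : borel (E * E)%type -> borel E) A = mu A /\
    pushforward theta (snd : borel (E * E)%type -> borel E) A = nu A].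

Definition wasserstein (p : R) (mu nu : probability (borel E) R) : \bar R :=
  ereal_inf [set ((\int[theta]_z (mdist (z.1 : E) z.2 `^ p)%:E) `^ p^-1)%E
            | theta in couplings mu nu].

Definition Bplus (n : nat) : set (E -> 'cV[R]_n) :=
  [set f | measurable_fun setT (f : borel E -> borel 'cV[R]_n) /\
           forall x i, 0 <= f x i 0].

End wasserstein.

(* Main.v *)
(* A coupling theta of the discrete measure mu with nu is carried by the fibers
   {x_i} * E, so it amounts to its conditional laws nu_i, which satisfy
   sum_i alpha_i nu_i = nu; each nu_i is then absolutely continuous with respect
   to nu, and its Radon-Nikodym density f_i can be normalised so that
   sum_i alpha_i f_i = 1 everywhere. When nu is discrete as well, only the matrix
   A_ij = f_i(y_j) matters. The costs of couplings, mixtures, densities and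
   matrices thus range over the same set of values.

   That the infimum is attained comes from L^2 instead of tightness of couplings:
   the admissible densities satisfy 0 <= f_i <= 1 / alpha_i and form a convex set,
   so the members of a minimizing sequence of nearly minimal L^2 norm are Cauchy by
   the parallelogram identity. With fast convergence they converge almost
   everywhere, and Fatou's lemma bounds the cost of the limit. *)
Require Import Defs.
From HB Require Import structures.
From mathcomp Require Import all_boot all_order all_algebra.
From mathcomp Require Import all_classical all_reals all_analysis.
From mathcomp Require Import measurable_realfun.
From mathcomp Require Import ring lra.

Set Implicit Arguments.
Unset Strict Implicit.
Unset Printing Implicit Defensive.

Import Order.TTheory GRing.Theory Num.Theory.
Import numFieldNormedType.Exports.

Local Open Scope classical_set_scope.
Local Open Scope ring_scope.

(** * Mixtures of probability measures and measures with a density *)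

Lemma mnormalizeE d (T : measurableType d) (R : realType)
    (mu : {measure set T -> \bar R}) (P : probability T R) (c : R) (A : set T) :
  0 < c -> mu setT = c%:E -> mnormalize mu P A = (mu A * (c^-1)%:E)%E.
Proof.
by move=> c0 muT; rewrite /mnormalize muT orbF eqe gt_eqF.
Qed.

Section mixture.
Context d (T : measurableType d) (R : realType).
Variables (n : nat) (alpha : 'cV[R]_n) (nus : 'I_n -> probability T R).
Hypothesis alpha_ge0 : forall i, 0 <= alpha i 0.

(** [msum] adds up a sequence of measures indexed by [nat], so the family is padded with the zero
    measure beyond [n]. *)
Let term (k : nat) : {measure set T -> \bar R} :=
  if insub k is Some i then mscale (NngNum (alpha_ge0 i)) (nus i) else mzero.

Let termE (i : 'I_n) : term i = mscale (NngNum (alpha_ge0 i)) (nus i).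
Proof. by rewrite /term valK. Qed.

Let mix_sumE A : msum term n A = (\sum_(i < n) (alpha i 0)%:E * nus i A)%E.
Proof. by rewrite /msum; apply: eq_bigr => i _; rewrite termE. Qed.

Lemma mixture_exists : \sum_(i < n) alpha i 0 = 1 ->
  exists P : probability T R, is_mixture alpha nus P.
Proof.
move=> alpha1; have mT : msum term n setT = 1%E.
  rewrite mix_sumE; under eq_bigr do rewrite probability_setT mule1.
  by rewrite sumEFin alpha1.
(* The sum has mass 1 already: normalising leaves its values alone and supplies the structure of a
   probability. *)
exists (mnormalize (msum term n) (dirac point)) => A mA /=.
by rewrite (mnormalizeE _ _ ltr01 mT) invr1 mule1; exact: mix_sumE.
Qed.

Lemma ge0_integral_mixture (P : probability T R) (g : T -> \bar R) :
  is_mixture alpha nus P -> measurable_fun setT g -> (forall x, 0 <= g x)%E ->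
  (\int[P]_x g x = \sum_(i < n) (alpha i 0)%:E * \int[nus i]_x g x)%E.
Proof.
move=> mix mg g0; rewrite (eq_measure_integral (msum term n)); last first.
  by move=> A mA _; exact: (etrans (mix A mA) (esym (mix_sumE A))).
rewrite ge0_integral_measure_sum//; apply: eq_bigr => i _.
by rewrite termE ge0_integral_mscale.
Qed.

End mixture.

Section density.
Context d (T : measurableType d) (R : realType).
Variables (P : probability T R) (h : T -> R).
Hypotheses (mh : measurable_fun setT h) (h0 : forall x, 0 <= h x).
Hypothesis h1 : (\int[P]_x (h x)%:E = 1)%E.

Let mhE : measurable_fun setT (EFin \o h). Proof. exact/measurable_EFinP. Qed.

Definition density_of (A : set T) := (\int[P]_(x in A) (h x)%:E)%E.

Let density_of0 : density_of set0 = 0%E.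
Proof. by rewrite /density_of integral_set0. Qed.

Let density_of_ge0 A : (0 <= density_of A)%E.
Proof. by apply: integral_ge0 => x _; rewrite lee_fin. Qed.

Let density_of_sigma_additive : semi_sigma_additive density_of.
Proof. by apply: semi_sigma_additive_nng_induced => // x; rewrite lee_fin. Qed.

HB.instance Definition _ := isMeasure.Build _ _ _ density_of
  density_of0 density_of_ge0 density_of_sigma_additive.

HB.instance Definition _ := Measure_isProbability.Build _ _ _ density_of h1.

Lemma density_exists : exists Q : probability T R,
  forall A, measurable A -> Q A = (\int[P]_(x in A) (h x)%:E)%E.
Proof.
by exists density_of.
Qed.

(** Change of variables holds for the Radon-Nikodym derivative of [Q], and this derivative equals
    [h] almost everywhere, having the same integral over every measurable set. *)
Lemma ge0_integral_density (Q : probability T R) (g : T -> \bar R) :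
  (forall A, measurable A -> Q A = (\int[P]_(x in A) (h x)%:E)%E) ->
  measurable_fun setT g -> (forall x, 0 <= g x)%E ->
  (\int[Q]_x g x = \int[P]_x (g x * (h x)%:E))%E.
Proof.
move=> QE mg g0.
have QP : Q `<< P.
  apply/null_content_dominatesP => A mA PA0.
  by apply: (etrans (QE A mA)); rewrite null_set_integral//; exact: measurable_funTS.
have intQ := Radon_Nikodym_SigmaFinite.f_integrable QP.
rewrite -(Radon_Nikodym_SigmaFinite.change_of_variables QP)//.
apply: ae_eq_integral => //.
- by apply: emeasurable_funM => //; exact: measurable_int intQ.
- exact: emeasurable_funM.
- apply: ae_eqe_mul2l; apply: integral_ae_eq => // A _ mA.
  by rewrite -Radon_Nikodym_SigmaFinite.f_integral//; exact: QE.
Qed.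

End density.

(** * Borel measurability of the metric, of sections and of vector-valued maps *)

Lemma measurable_fun_g_sigma_algebra (T U : pointedType) (G : set (set T))
    (H : set (set U)) (f : T -> U) :
  (forall B, H B -> G (f @^-1` B)) ->
  measurable_fun [set: g_sigma_algebraType G]
    (f : g_sigma_algebraType G -> g_sigma_algebraType H).
Proof.
move=> fHG; apply: (@measurability _ _ _ (g_sigma_algebraType H) _ _ H erefl).
by move=> _ [B HB <-]; rewrite setTI; apply: sub_sigma_algebra; exact: fHG.
Qed.

(** The target [R] carries its own sigma-algebra instead of [borel R]; it is generated by the open
    intervals. *)
Lemma measurable_fun_g_sigma_algebra_real (R : realType) (T : pointedType)
    (G : set (set T)) (f : T -> R) :
  (forall B, open B -> G (f @^-1` B)) ->
  measurable_fun [set: g_sigma_algebraType G] (f : g_sigma_algebraType G -> R).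
Proof.
move=> fG; apply: (measurability _ (measurable_realfun.RGenOpens.measurableE R)).
move=> _ [_ [a [b ->]] <-]; rewrite setTI.
by apply: sub_sigma_algebra; apply: fG; exact: interval_open.
Qed.

Lemma mdist_continuous (R : realType) (E : completeMetricType R) :
  continuous (fun z : E * E => mdist z.1 z.2).
Proof.
move=> [a b]; apply/cvgrPdist_lt => e e0 /=.
exists (ball a (e / 2), ball b (e / 2)).
  by split; apply: nbhsx_ballx; rewrite divr_gt0.
move=> [a' b'] [] /=; rewrite !ballEmdist /= => aa' bb'.
have h1 := metric_triangle a a' b; have h2 := metric_triangle a' b' b.
have h3 := metric_triangle a' a b'; have h4 := metric_triangle a b b'.
rewrite ltr_norml; rewrite (metric_sym a' a) (metric_sym b' b) in h2 h3.
apply/andP; split; lra.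
Qed.

Lemma measurable_mdist_powR (R : realType) (E : completeMetricType R) (p : R) :
  measurable_fun [set: borel (E * E)%type]
    (fun z : borel (E * E)%type => mdist (z.1 : E) z.2 `^ p).
Proof.
apply: (measurableT_comp (measurable_powR p)).
by apply: measurable_fun_g_sigma_algebra_real; exact/continuousP/mdist_continuous.
Qed.

Lemma measurable_pair_borel (R : realType) (E : completeMetricType R) (x : E) :
  measurable_fun [set: borel E]
    ((fun z => (x, z)) : borel E -> borel (E * E)%type).
Proof.
apply: measurable_fun_g_sigma_algebra; apply/continuousP => z.
by apply: cvg_pair => //; exact: cvg_cst.
Qed.

(** Coordinates are continuous. Conversely, an open set of vectors is a countable union of cubes
    with rational centres, and the preimage of a cube is a finite intersection of coordinate
    conditions. *)
Lemma measurable_fun_borel_cV (R : realType) d (T : measurableType d) n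
    (f : T -> 'cV[R]_n) :
  measurable_fun [set: T] (f : T -> borel 'cV[R]_n) <->
  forall i, measurable_fun [set: T] (fun x => f x i 0).
Proof.
split=> [mf i|mf].
  have ci : continuous (fun M : 'cV[R]_n => M i 0) by exact: coord_continuous.
  apply: (measurableT_comp (f := fun M : borel 'cV[R]_n => M i 0) _ mf).
  by apply: measurable_fun_g_sigma_algebra_real; exact/continuousP.
apply: (@measurability _ _ _ (borel 'cV[R]_n) _ _ (@open 'cV[R]_n) erefl).
move=> _ [U oU <-]; rewrite setTI.
pose box (q : 'cV[rat]_n * nat) :=
  [set M : 'cV[R]_n | forall i, `|ratr (q.1 i 0) - M i 0| < q.2.+1%:R^-1].
(* Indexing by all cubes, with the empty set in place of those not inside [U], keeps the index type
   countable. *)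
have -> : f @^-1` U =
    \bigcup_q (if `[< box q `<=` U >] then f @^-1` box q else set0).
  apply/seteqP; split=> [x Ufx|x [q _]]; last first.
    by case: ifP => // /asboolP qU /qU.
  have : nbhs (f x) U by exact: open_nbhs_nbhs.
  move=> /nbhs_ballP [e /= e0 eU].
  (* Half of [e], because both [f x] and any other point of the cube lie within [1 / k.+1] of its
     centre. *)
  have [k ke] : exists k : nat, k.+1%:R^-1 < e / 2.
    have [k] := @ltr_add_invr R 0 (e / 2) (divr_gt0 e0 (ltr0Sn _ 1)).
    by rewrite add0r; exists k.
  have [w w0 wE] : exists2 w : R, 0 < w & w = k.+1%:R^-1.
    by exists k.+1%:R^-1 => //; rewrite invr_gt0.
  have /choice[q qP] : forall i : 'I_n, exists q : rat,
      `|ratr q - f x i 0| < w.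
    move=> i; have lt2 : f x i 0 - w < f x i 0 + w by lra.
    have [q] := rat_in_itvoo lt2.
    rewrite in_itv /= => /andP[q1 q2]; exists q; rewrite ltr_norml.
    by apply/andP; split; lra.
  rewrite -wE in ke.
  exists (\col_i q i, k) => //.
  case: ifPn => [_ i|/asboolP]; first by rewrite mxE -wE.
  case=> M /= bM; apply: eU; split => // i j; rewrite (ord1 j).
  have := bM i; have := qP i; rewrite mxE -wE /ball /= => h1 h2.
  rewrite (le_lt_trans (ler_distD (ratr (q i)) _ _))// distrC; lra.
apply: countable_bigcupT_measurable; first exact: countableP.
move=> q; case: ifP => // _.
have -> : f @^-1` box q = \bigcap_(i in [set` predT])
    ((fun x => `|ratr (q.1 i 0) - f x i 0|) @^-1` `]-oo, q.2.+1%:R^-1[).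
  apply/seteqP; split=> [x h i _|x h i]; first by rewrite /= in_itv; exact: h.
  by have := h i isT; rewrite /= in_itv.
apply: fin_bigcap_measurable => // i _.
rewrite -[X in measurable X]setTI.
have : measurable_fun [set: T] (fun x => `|ratr (q.1 i 0) - f x i 0| : R).
  by apply: measurableT_comp => //; exact: measurable_funB.
by apply => //.
Qed.

Lemma measurable_set1_borel (R : realType) (E : completeMetricType R) (x : E) :
  measurable ([set x] : set (borel E)).
Proof.
rewrite -[X in measurable X]setCK; apply: measurableC.
apply: sub_sigma_algebra; apply: closed_openC; apply: accessible_closed_set1.
exact: hausdorff_accessible (@metric_hausdorff R E).
Qed.

(** * Near minimizers of a convex problem *)

(* A minimizing sequence for [J] whose members nearly minimize the strictly
   convex [Q] is Cauchy, by the parallelogram identity. *)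
Lemma minimizing_sequence_parallelogram (R : realType) (X : Type) (K : set X)
    (J : X -> \bar R) (Q : X -> R) (mid : X -> X -> X)
    (j M : R) (delta : nat -> R) :
  (forall e, 0 < e -> exists g, K g /\ (J g <= (j + e)%:E)%E) ->
  (forall g, K g -> 0 <= Q g <= M) ->
  (forall g h, K g -> K h -> K (mid g h)) ->
  (forall g h t, K g -> K h ->
     (J g <= t%:E)%E -> (J h <= t%:E)%E -> (J (mid g h) <= t%:E)%E) ->
  (forall k, 0 < delta k) -> (forall k, delta k.+1 <= delta k) ->
  exists g : nat -> X, forall k,
    [/\ K (g k), (J (g k) <= (j + k.+1%:R^-1)%:E)%E &
        (Q (g k) + Q (g k.+1)) / 2 - Q (mid (g k) (g k.+1)) <= delta k].
Proof.
move=> Jj QM Kmid Jmid delta0 delta_le.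
(* [sup S] is the limit, as [e] decreases to 0, of the infimum of [Q] over the points of [K] with
   [J] at most [j + e]. *)
pose S := [set q : R | exists2 e, 0 < e &
  forall h, K h -> (J h <= (j + e)%:E)%E -> q <= Q h].
have supS : has_sup S.
  split; first by exists 0, 1 => // h /QM /andP[].
  exists M => q [e e0 qe]; have [h [Kh Jh]] := Jj _ e0.
  by rewrite (le_trans (qe _ Kh Jh))//; case/andP: (QM _ Kh).
pose m := sup S.
have near_min e d : 0 < e -> 0 < d ->
    exists h, [/\ K h, (J h <= (j + e)%:E)%E & Q h <= m + d].
  move=> e0 d0; apply: contrapT => no.
  have : S (m + d).
    exists e => // h Kh Jh; rewrite leNgt; apply/negP => /ltW Qh.
    by apply: no; exists h.
  move=> /(ub_le_sup supS.2); rewrite -/m; lra.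
have lower d : 0 < d -> exists2 e, 0 < e &
    forall h, K h -> (J h <= (j + e)%:E)%E -> m - d <= Q h.
  move=> d0; have [q [e e0 qe] mq] := sup_adherent d0 supS.
  by exists e => // h Kh Jh; rewrite (le_trans (ltW mq))// qe.
have /choice[eps epsP] : forall k, exists e, 0 < e /\
    forall h, K h -> (J h <= (j + e)%:E)%E -> m - delta k / 3 <= Q h.
  move=> k; have [|e e0 eP] := lower (delta k / 3).
    by rewrite divr_gt0.
  by exists e.
(* [Q (g k)] exceeds [m] by at most a third of [delta k]; below the level given by [eps k], no point
   of [K] falls short of [m] by more than that. *)
have /choice[g gP] : forall k, exists h,
    [/\ K h, (J h <= (j + Num.min (eps k) k.+1%:R^-1)%:E)%E &
        Q h <= m + delta k / 3].
  move=> k; apply: near_min; last by rewrite divr_gt0.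
  by rewrite lt_min (epsP k).1 invr_gt0 ltr0Sn.
exists g => k; have [Kk Jk Qk] := gP k; have [Kl Jl Ql] := gP k.+1.
split=> //.
  by rewrite (le_trans Jk)// lee_fin lerD2l ge_min lexx orbT.
have Jke : (J (g k) <= (j + eps k)%:E)%E.
  by rewrite (le_trans Jk)// lee_fin lerD2l ge_min lexx.
have Jle : (J (g k.+1) <= (j + eps k.+1)%:E)%E.
  by rewrite (le_trans Jl)// lee_fin lerD2l ge_min lexx.
have := delta_le k; have := delta0 k.+1.
have le_wlog t : (eps k <= t)%R -> (eps k.+1 <= t)%R ->
    (J (mid (g k) (g k.+1)) <= (j + t)%:E)%E.
  move=> kt lt; apply: Jmid => //.
    by rewrite (le_trans Jke)// lee_fin lerD2l.
  by rewrite (le_trans Jle)// lee_fin lerD2l.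
have Kmk := Kmid _ _ Kk Kl.
(* The midpoint of two members is controlled at the larger of their two levels. In both cases its
   [Q] is at least [m - delta k / 3], as [delta] is nonincreasing, so the gap is at most two thirds
   of [delta k]. *)
have [ekl|/ltW elk] := leP (eps k) (eps k.+1).
  have := (epsP k.+1).2 _ Kmk (le_wlog _ ekl (lexx _)).
  lra.
have := (epsP k).2 _ Kmk (le_wlog _ (lexx _) elk).
lra.
Qed.

(** * Almost everywhere convergence *)

Section ae_convergence.
Context d (T : measurableType d) (R : realType) (P : {measure set T -> \bar R}).

(** By monotone convergence the sum of the increments has finite integral, hence is finite almost
    everywhere; there the telescoping series converges absolutely. *)
Lemma ae_cvg_summable_increments (g : nat -> T -> R) :
  (forall k, measurable_fun [set: T] (g k)) ->
  (\sum_(0 <= k <oo) \int[P]_x `|g k.+1 x - g k x|%:E < +oo)%E ->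
  {ae P, forall x, cvgn (g ^~ x)}.
Proof.
move=> mg sum_lty.
have mu k : measurable_fun [set: T] (fun x => `|g k.+1 x - g k x|%:E).
  apply/measurable_EFinP; apply: measurableT_comp => //.
  exact: measurable_funB.
have u0 k x : (0 <= `|g k.+1 x - g k x|%:E)%E by rewrite lee_fin.
have intS : P.-integrable [set: T]
    (fun x => \sum_(0 <= k <oo) `|g k.+1 x - g k x|%:E)%E.
  apply/integrableP; split; first exact: ge0_emeasurable_sum.
  under eq_integral do rewrite gee0_abs ?nneseries_ge0//.
  by rewrite integral_nneseries.
have := integrable_ae measurableT intS.
apply: filterS => x /(_ I) Sfin.
have : cvgn (series (fun k => `|g k.+1 x - g k x|)).
  apply: nnseries_is_cvg => //.
  by rewrite ltey_eq Sfin.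
move=> /(@normed_cvg _ _ (telescope (g ^~ x))).
rewrite telescopeK => cg.
have -> : g ^~ x = (fun k => (g k x - g 0%N x) + g 0%N x).
  by apply/funext => k; rewrite subrK.
by apply: is_cvgD => //; exact: is_cvg_cst.
Qed.

End ae_convergence.

(** * Existence of a cost-minimizing family of densities *)

Section minimal_density.
Context d (T : measurableType d) (R : realType) (P : probability T R).
Variables (n : nat) (alpha : 'cV[R]_n).
Hypotheses (alpha_gt0 : forall i, 0 < alpha i 0)
  (alpha1 : \sum_(i < n) alpha i 0 = 1).
Implicit Types (g h : 'I_n -> T -> R) (N : set T).

Definition densities (h : 'I_n -> T -> R) : Prop :=
  [/\ forall i, measurable_fun [set: T] (h i),
      forall i x, 0 <= h i x,
      forall x, \sum_(i < n) alpha i 0 * h i x = 1 &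
      forall i, (\int[P]_x (h i x)%:E = 1)%E].

(* Modifying the components to the constant 1 on a null set keeps the pointwise
   constraint [\sum_i alpha_i h_i = 1], since the weights sum to 1. *)
Definition set_one (N : set T) (h : 'I_n -> T -> R) : 'I_n -> T -> R :=
  fun i x => if x \in N then 1 else h i x.

(** This uniform bound makes the squares integrable and provides the dominating function when
    passing to the limit. *)
Lemma densities_le h i x : densities h -> h i x <= (alpha i 0)^-1.
Proof.
move=> [_ h0 hs _]; rewrite -[leRHS]mul1r ler_pdivlMr// mulrC -(hs x).
rewrite (bigD1 i)//= lerDl; apply: sumr_ge0 => k _.
by rewrite mulr_ge0// ltW.
Qed.

Lemma measurable_set_one N h : measurable N ->
  (forall i, measurable_fun [set: T] (h i)) ->
  forall i, measurable_fun [set: T] (set_one N h i).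
Proof.
move=> mN mh i; apply: measurable_fun_ifT => //.
have -> : (fun x => x \in N) = (fun x => (\1_N x == 1 :> R)).
  apply/funext => x; rewrite indicE.
  by case: (x \in N); rewrite /= ?eqxx// eq_sym oner_eq0.
by apply: measurable_fun_eqr => //; exact: measurable_indic.
Qed.

Lemma ae_eq_set_one N h i : measurable N -> P N = 0%E ->
  {ae P, forall x, set_one N h i x = h i x}.
Proof.
move=> mN PN; exists N; split=> // x /=; apply: contra_notP => Nx.
by rewrite /set_one memNset.
Qed.

Lemma densities_set_one N h : measurable N -> P N = 0%E ->
  (forall i, measurable_fun [set: T] (h i)) ->
  (forall i x, ~ N x -> 0 <= h i x) ->
  (forall x, ~ N x -> \sum_(i < n) alpha i 0 * h i x = 1) ->
  (forall i, \int[P]_x (set_one N h i x)%:E = 1)%E ->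
  densities (set_one N h).
Proof.
move=> mN PN mh h0 hs h1; split=> //; first exact: measurable_set_one.
  by move=> i x; rewrite /set_one; case: ifPn => // /negP Nx; apply: h0 => /mem_set.
move=> x; have [xN|Nx] := boolP (x \in N).
  by rewrite -[RHS]alpha1; apply: eq_bigr => i _; rewrite /set_one xN mulr1.
rewrite -[RHS](hs x); last by move=> xN; rewrite mem_set in Nx.
by apply: eq_bigr => i _; rewrite /set_one (negbTE Nx).
Qed.

(** These are the densities of the product coupling, where every [nu_i] is [nu]; they serve as the
    minimizer when all costs are infinite. *)
Lemma densities_cst1 : densities (fun=> cst 1).
Proof.
split=> [i|i x|x|i] //.
- by rewrite -[RHS]alpha1; apply: eq_bigr => i _; rewrite mulr1.
- by rewrite (eq_integral (cst 1%E))// integral_cst// mul1e; exact: probability_setT.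
Qed.

Lemma densities_midpoint g h : densities g -> densities h ->
  densities (fun i x => (g i x + h i x) / 2).
Proof.
move=> [mg g0 gs g1] [mh h0 hs h1]; split=> [i|i x|x|i].
- by apply: measurable_funM => //; exact: measurable_funD.
- by rewrite divr_ge0// addr_ge0.
- under eq_bigr do rewrite mulrA mulrDr.
  by rewrite -mulr_suml big_split /= gs hs -[1 + 1]/(2 : R) divff.
- under eq_integral do rewrite EFinM EFinD.
  rewrite ge0_integralZr//; last 2 first.
  + by apply: emeasurable_funD; exact/measurable_EFinP.
  + by move=> x _; rewrite adde_ge0// lee_fin.
  rewrite ge0_integralD//; last 4 first.
  + by move=> x _; rewrite lee_fin.
  + exact/measurable_EFinP.
  + by move=> x _; rewrite lee_fin.
  + exact/measurable_EFinP.
  by rewrite g1 h1 -EFinD -EFinM divff.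
Qed.

Variable c : 'I_n -> T -> R.
Hypotheses (mc : forall i, measurable_fun [set: T] (c i))
  (c0 : forall i x, 0 <= c i x).

Definition density_cost (h : 'I_n -> T -> R) : \bar R :=
  (\int[P]_x (\sum_(i < n) alpha i 0 * c i x * h i x)%:E)%E.

Lemma measurable_density_integrand h :
  (forall i, measurable_fun [set: T] (h i)) ->
  measurable_fun [set: T] (fun x => \sum_(i < n) alpha i 0 * c i x * h i x).
Proof.
move=> mh; apply: measurable_sum => i; apply: measurable_funM => //.
by apply: measurable_funM.
Qed.

Lemma density_integrand_ge0 h x : (forall i x, 0 <= h i x) ->
  0 <= \sum_(i < n) alpha i 0 * c i x * h i x.
Proof.
by move=> h0; apply: sumr_ge0 => i _; rewrite !mulr_ge0// ltW.
Qed.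

Lemma density_cost_ge0 h : densities h -> (0 <= density_cost h)%E.
Proof.
move=> [_ h0 _ _]; apply: integral_ge0 => x _.
by rewrite lee_fin density_integrand_ge0.
Qed.

(** The cost is affine in the densities, so the midpoint has the average of the two costs. *)
Lemma density_cost_midpoint g h (t : R) : densities g -> densities h ->
  (density_cost g <= t%:E)%E -> (density_cost h <= t%:E)%E ->
  (density_cost (fun i x => (g i x + h i x) / 2)%R <= t%:E)%E.
Proof.
move=> [mg g0 _ _] [mh h0 _ _] gt ht; rewrite /density_cost.
pose G u x : R := \sum_(i < n) alpha i 0 * c i x * u i x.
have GE x : \sum_(i < n) alpha i 0 * c i x * ((g i x + h i x) / 2) =
    (G g x + G h x) / 2 :> R.
  rewrite -big_split /= mulr_suml; apply: eq_bigr => i _.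
  by rewrite -mulrDr mulrA.
under eq_integral do rewrite GE EFinM EFinD.
rewrite ge0_integralZr//; last 2 first.
- by apply: emeasurable_funD; apply/measurable_EFinP;
    exact: measurable_density_integrand.
- by move=> x _; rewrite adde_ge0// lee_fin density_integrand_ge0.
rewrite ge0_integralD//; last 4 first.
- by move=> x _; rewrite lee_fin density_integrand_ge0.
- by apply/measurable_EFinP; exact: measurable_density_integrand.
- by move=> x _; rewrite lee_fin density_integrand_ge0.
- by apply/measurable_EFinP; exact: measurable_density_integrand.
rewrite -lee_pdivlMr ?invr_gt0// (le_trans (leeD gt ht))//.
by rewrite invrK -EFinM -EFinD lee_fin; lra.
Qed.

Lemma integrable_bounded (f : T -> R) (M : R) : measurable_fun [set: T] f ->
  (forall x, `|f x| <= M) -> P.-integrable [set: T] (EFin \o f).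
Proof.
move=> mf fM; apply: measurable_bounded_integrable => //.
  by apply: (le_lt_trans (probability_le1 P measurableT)); rewrite ltry.
exists M; split; first exact: num_real.
by move=> B MB x _; exact: (le_trans (fM x) (ltW MB)).
Qed.

(** The squared L^2 norm. For admissible densities the integrand is bounded, so taking the integral
    as a real number loses nothing. *)
Definition sqr_density h : R := (\int[P]_x (\sum_(i < n) h i x ^+ 2))%R.

Let bound : R := \sum_(i < n) (alpha i 0)^-1 ^+ 2.

Let measurable_sqr h : (forall i, measurable_fun [set: T] (h i)) ->
  measurable_fun [set: T] (fun x => \sum_(i < n) h i x ^+ 2).
Proof. by move=> mh; apply: measurable_sum => i; exact: measurable_funX. Qed.

Let sqr_le h x : densities h -> 0 <= \sum_(i < n) h i x ^+ 2 <= bound.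
Proof.
move=> dh; apply/andP; split; first by apply: sumr_ge0 => i _; exact: sqr_ge0.
apply: ler_sum => i _; rewrite lerXn2r ?nnegrE ?densities_le//.
  by case: dh.
by rewrite invr_ge0 ltW.
Qed.

Let integrable_sqr h : densities h ->
  P.-integrable [set: T] (EFin \o (fun x => \sum_(i < n) h i x ^+ 2)).
Proof.
move=> dh; apply: (@integrable_bounded _ bound).
  by apply: measurable_sqr; case: dh.
by move=> x; have /andP[s0 sb] := sqr_le x dh; rewrite ger0_norm.
Qed.

Lemma sqr_density_parallelogram g h : densities g -> densities h ->
  (\int[P]_x (\sum_(i < n) (g i x - h i x) ^+ 2))%R =
  4 * ((sqr_density g + sqr_density h) / 2 -
       sqr_density (fun i x => (g i x + h i x) / 2)).
Proof.
move=> dg dh; have dm := densities_midpoint dg dh.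
have ig := integrable_sqr dg; have ih := integrable_sqr dh.
have im := integrable_sqr dm.
pose S (u : 'I_n -> T -> R) x := \sum_(i < n) u i x ^+ 2.
have SE x : \sum_(i < n) (g i x - h i x) ^+ 2 =
    2 * (S g x + S h x) - 4 * S (fun i x => (g i x + h i x) / 2) x.
  rewrite -big_split /= !mulr_sumr -sumrB; apply: eq_bigr => i _.
  by field.
under eq_Rintegral do rewrite SE.
rewrite RintegralB//; last 2 first.
- by apply: (integrableZl measurableT 2 (integrableD measurableT ig ih)).
- exact: (integrableZl measurableT 4 im).
rewrite RintegralZl//; last exact: (integrableD measurableT ig ih).
rewrite RintegralD// RintegralZl//.
by rewrite /sqr_density /S; field.
Qed.

(** The pointwise constraints pass to the limit directly, the integrals by dominated convergence
    with the bound [(alpha i 0)^-1], and the cost, whose integrand need not be dominated, by Fatou's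
    lemma. *)
Lemma density_cost_lim (f : nat -> 'I_n -> T -> R) h (j : R) :
  (forall k, densities (f k)) ->
  (forall i x, f ^~ i ^~ x @ \oo --> h i x) ->
  (forall k, (density_cost (f k) <= (j + k.+1%:R^-1)%:E)%E) ->
  densities h /\ (density_cost h <= j%:E)%E.
Proof.
move=> df fh fj.
have mh i : measurable_fun [set: T] (h i).
  apply: (measurable_fun_cvg (h := fun k => f k i)) => [k|x _]; last exact: fh.
  by case: (df k).
have h0 i x : 0 <= h i x.
  by apply: (cvgr_to_ge (fh i x)); apply: nearW => k; case: (df k).
split.
  split=> // [x|i].
    have fsum : (fun k => \sum_(i < n) alpha i 0 * f k i x) @ \oo -->
        \sum_(i < n) alpha i 0 * h i x.
      apply: cvg_big => [|i _]; first exact: add_continuous.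
      by apply: cvgMl_tmp; exact: fh.
    apply: (cvg_unique (@Rhausdorff R) fsum).
    have -> : (fun k => \sum_(i < n) alpha i 0 * f k i x) = cst 1.
      by apply/funext => k; case: (df k).
    exact: cvg_cst.
  have [|||||_ _] := @dominated_convergence _ _ _ P _ measurableT
    (fun k x => (f k i x)%:E) (fun x => (h i x)%:E) (cst (alpha i 0)^-1%:E).
  - by move=> k; apply/measurable_EFinP; case: (df k).
  - exact/measurable_EFinP.
  - by apply: aeW => x _; apply: cvg_EFin; [exact: nearW|exact: fh].
  - exact: finite_measure_integrable_cst.
  - apply: aeW => x k _; rewrite lee_fin ger0_norm ?densities_le//.
    by case: (df k).
  move=> flim; apply: (cvg_unique (@ereal_hausdorff R) flim).
  have -> : (fun k => \int[P]_x (f k i x)%:E)%E = cst 1%E.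
    by apply/funext => k; case: (df k).
  exact: cvg_cst.
pose F k x := (\sum_(i < n) alpha i 0 * c i x * f k i x)%:E.
have mF k : measurable_fun [set: T] (F k).
  apply/measurable_EFinP; apply: measurable_density_integrand.
  by case: (df k).
have F0 k x : [set: T] x -> (0 <= F k x)%E.
  by move=> _; rewrite lee_fin density_integrand_ge0//; case: (df k).
(* The integrands converge pointwise, so their limit inferior is the integrand of the limit. *)
have -> : density_cost h = (\int[P]_x limn_einf (F ^~ x))%E.
  apply: eq_integral => x _; apply/esym.
  apply: (fun H => (cvg_limn_einf_sup H).1).
  apply: cvg_EFin; first exact: nearW.
  by apply: cvg_big => [|i _]; [exact: add_continuous|apply: cvgMl_tmp]; exact: fh.
apply: (le_trans (fatou P measurableT mF F0)).
have cj : (fun k => (j + k.+1%:R^-1)%:E) @ \oo --> j%:E.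
  apply: cvg_EFin; first exact: nearW.
  rewrite -[X in _ --> X]addr0; apply: cvgD; first exact: cvg_cst.
  exact: cvg_harmonic.
rewrite -[leRHS](cvg_limn_einf_sup cj).1 !limn_einf_lim.
apply: lee_lim; [exact: is_cvg_einfs|exact: is_cvg_einfs|].
apply: nearW => k; apply: le_ereal_inf_tmp => _ [m /= km <-].
by apply: le_trans (fj m); apply: ereal_inf_lbound; exists m.
Qed.

Let mid (g h : 'I_n -> T -> R) : 'I_n -> T -> R :=
  fun i x => (g i x + h i x) / 2.

(** By the parallelogram identity the squared L^2 distance of [g] and [h] is at most [4 * e ^+ 2].
    The pointwise bound [w <= e + w ^+ 2 / e] for [w = |h i x - g i x|] then integrates over a
    probability measure to at most [e + 4 * e], whence the constant 5. *)
Lemma integral_increment_le g h (e : R) : 0 < e -> densities g -> densities h ->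
  (sqr_density g + sqr_density h) / 2 - sqr_density (mid g h) <= e ^+ 2 ->
  forall i, (\int[P]_x `|h i x - g i x|%:E <= (5 * e)%:E)%E.
Proof.
move=> e0 dg dh gap i.
have [mg g0 _ _] := dg; have [mh h0 _ _] := dh.
pose q x := \sum_(i < n) (g i x - h i x) ^+ 2.
have mq : measurable_fun [set: T] q.
  by apply: measurable_sum => k; apply: measurable_funX; exact: measurable_funB.
have iq : P.-integrable [set: T] (EFin \o q).
  apply: (@integrable_bounded _ bound) => // x.
  rewrite ger0_norm; last by apply: sumr_ge0 => k _; exact: sqr_ge0.
  apply: ler_sum => k _; rewrite -real_normK ?num_real// lerXn2r ?nnegrE//.
    by rewrite invr_ge0 ltW.
  have := densities_le k x dg; have := densities_le k x dh.
  have := g0 k x; have := h0 k x.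
  by move=> *; rewrite ler_norml; apply/andP; split; lra.
have intq : (\int[P]_x q x)%R <= 4 * e ^+ 2.
  by rewrite (sqr_density_parallelogram dg dh) ler_pM2l.
have mw : measurable_fun [set: T] (fun x => `|h i x - g i x|).
  by apply: measurableT_comp => //; exact: measurable_funB.
have wq x : `|h i x - g i x| <= e + e^-1 * q x.
  have : `|h i x - g i x| ^+ 2 <= q x.
    rewrite real_normK ?num_real// -sqrrN opprB /q (bigD1 i)//= lerDl.
    by apply: sumr_ge0 => k _; exact: sqr_ge0.
  (* AM-GM: 2 e w <= e ^ 2 + w ^ 2 *)
  move=> wq; rewrite -(ler_pM2l e0) mulrDr mulrA divff ?gt_eqF// mul1r.
  have := sqr_ge0 (`|h i x - g i x| - e); have := sqr_ge0 e; nra.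
have ieq : P.-integrable [set: T] (EFin \o (fun x => e + e^-1 * q x)).
  apply: (integrableD measurableT (finite_measure_integrable_cst P e measurableT)
    (integrableZl measurableT e^-1 iq)).
apply: (@le_trans _ _ (\int[P]_x (e + e^-1 * q x)%:E)%E).
  apply: ge0_le_integral => //.
  - exact/measurable_EFinP.
  - by apply/measurable_EFinP; apply: measurable_funD => //; exact: measurable_funM.
  - by move=> x _; rewrite lee_fin.
rewrite -[leLHS]fineK ?integrable_fin_num// lee_fin.
rewrite [leLHS](RintegralD measurableT
  (finite_measure_integrable_cst P e measurableT) (integrableZl measurableT e^-1 iq)).
rewrite RintegralZl// Rintegral_cst//.
have -> : fine (P [set: T]) = 1 by rewrite [X in fine X]probability_setT.
rewrite mulr1 -(ler_pM2l e0) mulrDr mulrA divff ?gt_eqF// mul1r.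
by nra.
Qed.

(** The gap at index [k] is at most the square of [2^-(k+1)], so the L^1 increments are at most
    [5 / 2^(k+1)], the terms of a convergent geometric series. *)
Lemma ae_cvg_densities (g : nat -> 'I_n -> T -> R) :
  (forall k, densities (g k)) ->
  (forall k, (sqr_density (g k) + sqr_density (g k.+1)) / 2 -
     sqr_density (mid (g k) (g k.+1)) <= ((2 ^ k.+1)%:R^-1) ^+ 2) ->
  {ae P, forall x i, cvgn (fun k => g k i x)}.
Proof.
move=> dg gap; apply: filter_forall => i.
apply: ae_cvg_summable_increments => [k|]; first by case: (dg k).
apply: (@le_lt_trans _ _ (\sum_(0 <= k <oo) (5 / (2 ^ (k + 1))%:R)%:E)%E).
  apply: lee_nneseries => [k _ _|k _]; first exact: integral_ge0.
  by rewrite addn1; apply: integral_increment_le.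
have /cvg_lim := @cvg_geometric_eseries_half R 5 0.
by move=> ->//; rewrite ltry.
Qed.

Lemma minimal_density_exists : exists2 h, densities h &
  forall g, densities g -> (density_cost h <= density_cost g)%E.
Proof.
pose jE := ereal_inf (density_cost @` densities).
have jE_le g : densities g -> (jE <= density_cost g)%E.
  by move=> dg; apply: ereal_inf_lbound; exists g.
have jE0 : (0 <= jE)%E.
  by apply: le_ereal_inf_tmp => _ [g dg <-]; exact: density_cost_ge0.
have [jEy|jEfin] := eqVneq jE +oo%E.
  exists (fun=> cst 1); first exact: densities_cst1.
  by move=> g /jE_le; rewrite jEy leye_eq => /eqP ->; rewrite leey.
have jfin : jE \is a fin_num by rewrite ge0_fin_numE// ltey.
pose j := fine jE; have jEj : jE = j%:E by rewrite fineK.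
have [||||||g gP] := @minimizing_sequence_parallelogram R _ densities
  density_cost sqr_density mid j bound
  (fun k => ((2 ^ k.+1)%:R^-1) ^+ 2).
- move=> e e0; have [_ [g dg <-] ge] := lb_ereal_inf_adherent e0 jfin.
  by exists g; split => //; rewrite EFinD -jEj ltW.
- move=> g dg; apply/andP; split.
    by apply: Rintegral_ge0 => x _; apply: sumr_ge0 => i _; exact: sqr_ge0.
  have -> : bound = (\int[P]_(x in [set: T]) bound)%R.
    rewrite Rintegral_cst//.
    have -> : fine (P [set: T]) = 1 by rewrite [X in fine X]probability_setT.
    by rewrite mulr1.
  apply: le_Rintegral => //; first exact: integrable_sqr.
    exact: finite_measure_integrable_cst.
  by move=> x _; have /andP[] := sqr_le x dg.
- by move=> g h dg dh; exact: densities_midpoint.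
- by move=> g h t dg dh; exact: density_cost_midpoint.
- by move=> k; rewrite exprn_gt0// invr_gt0 ltr0n expn_gt0.
- move=> k; rewrite lerXn2r ?nnegrE ?invr_ge0//.
  by rewrite lef_pV2 ?posrE ?ltr0n ?expn_gt0// ler_nat leq_exp2l.
have [||N [mN PN Ncvg]] := @ae_cvg_densities g.
- by move=> k; case: (gP k).
- by move=> k; case: (gP k).
(* On the exceptional null set all members are replaced by the constant 1, so the sequence converges
   at every point while its constraints and its costs are preserved. *)
pose f k := set_one N (g k).
have ae_f k i : ae_eq P [set: T] (EFin \o f k i) (EFin \o g k i).
  by apply: filterS (ae_eq_set_one (g k) i mN PN) => x /= eqx _; rewrite /f eqx.
have mg k i : measurable_fun [set: T] (g k i) by have [[]] := gP k.
have df k : densities (f k).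
  have [[_ g0 gs g1] _ _] := gP k.
  apply: densities_set_one => // i; rewrite -(g1 i).
  apply: ge0_ae_eq_integral => //.
  - exact/measurable_EFinP/measurable_set_one.
  - exact/measurable_EFinP.
  - by move=> x _; rewrite lee_fin /set_one; case: ifP.
  - by move=> x _; rewrite lee_fin.
  - exact: ae_f.
have cost_f k : density_cost (f k) = density_cost (g k).
  have [[_ g0 gs g1] _ _] := gP k; have [_ f0 _ _] := df k.
  apply: ge0_ae_eq_integral => //.
  - exact/measurable_EFinP/measurable_density_integrand/measurable_set_one.
  - exact/measurable_EFinP/measurable_density_integrand.
  - by move=> x _; rewrite lee_fin density_integrand_ge0.
  - by move=> x _; rewrite lee_fin density_integrand_ge0.
  have : {ae P, forall x i, f k i x = g k i x}.
    by apply: filter_forall => i; exact: ae_eq_set_one.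
  by apply: filterS => x fgx _ /=; congr EFin; apply: eq_bigr => i _; rewrite fgx.
have fcvg i x : cvgn (fun k => f k i x).
  rewrite /f /set_one; case: (boolP (x \in N)) => [_|Nx]; first exact: is_cvg_cst.
  move: i; apply: contrapT => ncvg.
  by move: Nx; rewrite mem_set //; apply: Ncvg.
have [//|||dh hj] := @density_cost_lim f (fun i x => limn (fun k => f k i x)) j.
- by move=> i x; exact: fcvg.
- by move=> k; rewrite cost_f; case: (gP k).
exists (fun i x => limn (fun k => f k i x)) => // u du.
by rewrite (le_trans hj)// -jEj jE_le.
Qed.

End minimal_density.

(** * Mixtures equal to [P] and families of densities *)

Section mixture_density.
Context d (T : measurableType d) (R : realType).
Variables (n : nat) (alpha : 'cV[R]_n).
Hypotheses (alpha_gt0 : forall i, 0 < alpha i 0)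
  (alpha1 : \sum_(i < n) alpha i 0 = 1).
Variable P : probability T R.
Implicit Types (nus : 'I_n -> probability T R) (h : 'I_n -> T -> R).

Definition has_densities nus h := forall i A, measurable A ->
  nus i A = (\int[P]_(x in A) (h i x)%:E)%E.

Lemma mixture_of_densities h : densities P alpha h ->
  exists2 nus, is_mixture alpha nus P & has_densities nus h.
Proof.
move=> [mh h0 hs h1].
have /choice[nus nusE] : forall i, exists Q : probability T R,
    forall A, measurable A -> Q A = (\int[P]_(x in A) (h i x)%:E)%E.
  by move=> i; exact: density_exists.
exists nus => // A mA.
under eq_bigr do rewrite nusE//.
have mhA i : measurable_fun A (fun x => (h i x)%:E).
  by apply/measurable_funTS/measurable_EFinP.
under eq_bigr => i _.
  rewrite -ge0_integralZl//; last 2 first.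
    by move=> x _; rewrite lee_fin.
    by rewrite lee_fin ltW.
  over.
rewrite -ge0_integral_sum//; last 2 first.
- by move=> i; exact: measurable_funeM.
- by move=> i x _; rewrite mule_ge0// lee_fin// ltW.
rewrite (eq_integral (cst 1%E)); last first.
  by move=> x _; rewrite -[RHS]/(1%:E) -(hs x) -sumEFin.
by rewrite integral_cst// mul1e.
Qed.

(** Since [alpha i 0 > 0], a null set of [P] is null for each [nus i], so Radon-Nikodym applies. The
    weighted sum of the derivatives has the same integrals as the constant 1, hence equals 1 off a
    null set [N], on which the derivatives are reset to 1. *)
Lemma densities_of_mixture nus : is_mixture alpha nus P ->
  exists2 h, densities P alpha h & has_densities nus h.
Proof.
move=> mix.
have dom i : nus i `<< P.
  apply/null_content_dominatesP => A mA PA0.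
  have := mix A mA; rewrite [LHS]PA0 => /esym/eqP.
  rewrite seq_psume_eq0 => [/allP/(_ i)|k _]; last first.
    by rewrite mule_ge0// lee_fin ltW.
  rewrite mem_index_enum => /(_ isT); rewrite implyTb mule_eq0 eqe gt_eqF//=.
  by move/eqP.
pose g i := Radon_Nikodym_SigmaFinite.f (nus i) P.
have gfin i x : g i x \is a fin_num.
  exact: (Radon_Nikodym_SigmaFinite.f_fin_num (dom i)).
have g0 i x : (0 <= g i x)%E by exact: (Radon_Nikodym_SigmaFinite.f_ge0 (dom i)).
have ig i : P.-integrable [set: T] (g i).
  exact: (Radon_Nikodym_SigmaFinite.f_integrable (dom i)).
have mgi i : measurable_fun [set: T] (g i) by exact: measurable_int (ig i).
have gE i A : measurable A -> nus i A = (\int[P]_(x in A) g i x)%E.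
  by move=> mA; exact: (Radon_Nikodym_SigmaFinite.f_integral (dom i)).
(* The derivatives are finite at every point, so [fine] changes no value. *)
pose h i x := fine (g i x).
have hE i x : (h i x)%:E = g i x by rewrite fineK.
have h0 i x : 0 <= h i x by rewrite fine_ge0.
have mh i : measurable_fun [set: T] (h i).
  apply/measurable_EFinP.
  by rewrite (_ : EFin \o h i = g i)//; apply/funext => x; exact: hE.
have msum : measurable_fun [set: T] (fun x => \sum_(i < n) alpha i 0 * h i x).
  by apply: measurable_sum => i; exact: measurable_funM.
pose N := [set x | \sum_(i < n) alpha i 0 * h i x != 1].
have mN : measurable N.
  have -> : N = ~` ((fun x => \sum_(i < n) alpha i 0 * h i x) @^-1` [set 1]).
    by apply/seteqP; split => x /= /eqP.
  by apply: measurableC; rewrite -[X in measurable X]setTI; exact: msum.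
have PN : P N = 0%E.
  have : ae_eq P [set: T] (cst 1%E)
      (fun x => (\sum_(i < n) alpha i 0 * h i x)%:E).
    apply: integral_ae_eq => //.
    - exact: finite_measure_integrable_cst.
    - exact/measurable_EFinP.
    - move=> A _ mA; rewrite integral_cst// mul1e.
      under eq_integral do rewrite -sumEFin.
      rewrite ge0_integral_sum//; last 2 first.
      + move=> i; apply/measurable_EFinP; apply: measurable_funM => //.
        exact: measurable_funTS.
      + by move=> i x _; rewrite lee_fin mulr_ge0// ltW.
      apply: (etrans (mix A mA)); apply: eq_bigr => i _.
      under eq_integral do rewrite EFinM hE.
      rewrite ge0_integralZl// ?gE//; first exact: measurable_funTS.
      by rewrite lee_fin ltW.
  move=> [M [mM PM subM]]; apply: (subset_measure0 mN mM _ PM).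
  by move=> x /= /eqP Nx; apply: subM => /= /(_ I) /esym [].
have ae_h i : ae_eq P [set: T] (fun x => (set_one N h i x)%:E) (g i).
  apply: filterS (ae_eq_set_one h i mN PN) => x /= eqx _.
  by rewrite eqx hE.
have ms i := measurable_set_one mN mh i.
have int_one i A : measurable A ->
    (\int[P]_(x in A) (set_one N h i x)%:E = nus i A)%E.
  move=> mA; rewrite gE//; apply: ae_eq_integral => //.
  - exact/measurable_funTS/measurable_EFinP.
  - exact: measurable_funTS.
  - exact: ae_eq_subset (ae_h i).
exists (set_one N h); last by move=> i A mA; rewrite int_one.
apply: densities_set_one => //.
- by move=> x /negP; rewrite negbK => /eqP.
- by move=> i; rewrite int_one// probability_setT.
Qed.

Lemma mixture_cost (c : 'I_n -> T -> R) nus h :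
  (forall i, measurable_fun [set: T] (c i)) -> (forall i x, 0 <= c i x) ->
  densities P alpha h -> has_densities nus h ->
  (\sum_(i < n) (alpha i 0)%:E * \int[nus i]_x (c i x)%:E =
    density_cost P alpha c h)%E.
Proof.
move=> mc c0 [mh h0 hs h1] nush.
under eq_bigr => i _.
  rewrite (ge0_integral_density (mh i) (nush i)); last 2 first.
  - exact/measurable_EFinP.
  - by move=> x; rewrite lee_fin.
  rewrite -ge0_integralZl//; last 3 first.
  - by apply: emeasurable_funM; exact/measurable_EFinP.
  - by move=> x _; rewrite mule_ge0// lee_fin.
  - by rewrite lee_fin ltW.
  over.
rewrite -ge0_integral_sum//; last 2 first.
- move=> i; apply: measurable_funeM.
  by apply: emeasurable_funM; exact/measurable_EFinP.
- by move=> i x _; rewrite !mule_ge0// lee_fin// ltW.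
apply: eq_integral => x _; rewrite -sumEFin; apply: eq_bigr => i _.
by rewrite muleA -!EFinM.
Qed.

End mixture_density.

(** * Couplings with a discrete measure as mixtures over fibers *)

Section couplings_of_discrete.
Context (R : realType) (E : completeMetricType R).

(** Named, as is [second], so that measurability can be attached as the structure which
    [distribution] expects. *)
Definition pair_left (a : E) : borel E -> borel (E * E)%type := fun z => (a, z).

HB.instance Definition _ (a : E) := isMeasurableFun.Build _ _ _ _ (pair_left a)
  (measurable_pair_borel a).

Definition second : borel (E * E)%type -> borel E := snd.

Let measurable_first :
  measurable_fun [set: borel (E * E)%type] (fst : borel (E * E)%type -> borel E).
Proof.
apply: measurable_fun_g_sigma_algebra.
by apply/continuousP => z; exact: cvg_fst.
Qed.

Let measurable_second : measurable_fun [set: borel (E * E)%type] second.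
Proof.
apply: measurable_fun_g_sigma_algebra.
by apply/continuousP => z; exact: cvg_snd.
Qed.

HB.instance Definition _ := isMeasurableFun.Build _ _ _ _ second
  measurable_second.

Variables (n : nat) (x : 'I_n -> E) (alpha : 'cV[R]_n).
Hypotheses (x_inj : injective x) (alpha_gt0 : forall i, 0 < alpha i 0)
  (alpha1 : \sum_(i < n) alpha i 0 = 1).
Variables (mu nu : probability (borel E) R).
Hypothesis mu_eq : is_mixture alpha (fun i => \d_(x i : borel E)) mu.

(* A coupling with the discrete [mu] is a mixture of measures carried by the
   fibers [{x i} * E]. *)
Definition glued (nus : 'I_n -> probability (borel E) R) i :
    probability (borel (E * E)%type) R :=
  distribution (nus i) (pair_left (x i)).

Let dirac_borelE (a : E) (A : set (borel E)) :
  (\d_(a : borel E) : probability (borel E) R) A = ((a \in A)%:R : R)%:E.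
Proof. exact: diracE. Qed.

Lemma coupling_of_mixture nus : is_mixture alpha nus nu ->
  exists2 theta, couplings mu nu theta & is_mixture alpha (glued nus) theta.
Proof.
move=> mix.
have [theta thetaE] :=
  mixture_exists (glued nus) (fun i => ltW (alpha_gt0 i)) alpha1.
exists theta => // A mA; split.
  apply: (etrans (thetaE _ _)).
    by rewrite -[X in measurable X]setTI; exact: measurable_first.
  apply: (etrans _ (esym (mu_eq mA))); apply: eq_bigr => i _; congr (_ * _)%E.
  apply: (etrans _ (esym (dirac_borelE _ _))).
  (* The first coordinate is constantly [x i] under the [i]-th component, so the preimage of [A] is
     everything or empty. *)
  apply: (@etrans _ _ (nus i (if x i \in A then setT else set0))).
    congr (nus i _); rewrite predeqE => z.
    case: ifPn => [/set_mem xA|/negP xA]; split=> // zA.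
    by apply: xA; exact: mem_set zA.
  by case: ifP => _; [exact: probability_setT|exact: measure0].
(* [snd] undoes each [pair_left (x i)], so the components have second marginals [nus i]. *)
apply: (etrans (thetaE _ _)).
  by rewrite -[X in measurable X]setTI; exact: measurable_second.
exact: (esym (mix _ mA)).
Qed.

(** The fibers [B i] are disjoint with masses [alpha i 0], which add up to 1, so [theta] is the
    mixture of its conditional laws on them; [nus i] is the second marginal of the [i]-th law. *)
Lemma mixture_of_coupling theta : couplings mu nu theta ->
  exists2 nus, is_mixture alpha nus nu & is_mixture alpha (glued nus) theta.
Proof.
move=> cpl.
pose B i : set (borel (E * E)%type) := fst @^-1` [set x i].
have mB i : measurable (B i).
  rewrite -[X in measurable X]setTI; apply: measurable_first => //.
  exact: measurable_set1_borel.
have thetaB i : theta (B i) = (alpha i 0)%:E.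
  apply: (etrans (cpl _ (measurable_set1_borel (x i))).1).
  apply: (etrans (mu_eq (measurable_set1_borel (x i)))).
  under eq_bigr => k _ do rewrite [X in (_ * X)%E]dirac_borelE.
  rewrite (bigD1 i)//= mem_set// mule1 big1 ?adde0// => k ki.
  rewrite memNset ?mule0//= => /x_inj ik.
  by rewrite ik eqxx in ki.
pose U := \big[setU/set0]_(i < n) B i.
have mU : measurable U by exact: bigsetU_measurable.
have trivB : trivIset [set: 'I_n] B.
  by move=> i k _ _ [z []]; rewrite /B /= => -> /x_inj.
have thetaU : theta U = 1%E.
  rewrite measure_bigsetU_ord// -[RHS]/(1%:E) -alpha1 -sumEFin.
  by apply: eq_bigr => i _; exact: thetaB.
have thetaE C : measurable C -> theta C = (\sum_(i < n) theta (C `&` B i))%E.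
  move=> mC; rewrite -measure_bigsetU_ord//; last 2 first.
  - by move=> i; exact: measurableI.
  - exact: trivIset_setIl.
  rewrite -big_distrr /= -/U.
  have null : theta (C `&` ~` U) = 0%E.
    apply: (subset_measure0 (measurableI _ _ mC (measurableC mU)) (measurableC mU)).
      exact: subIsetr.
    apply: (etrans (probability_setC theta mU)).
    by apply: (etrans (congr1 (fun t => 1 - t)%E thetaU)); rewrite subee.
  rewrite -[in LHS](setIT C) -(setUv U) setIUr measureU//.
  - by rewrite [X in (_ + X)%E](_ : _ = 0%E) ?adde0.
  - exact: measurableI.
  - by apply: measurableI => //; exact: measurableC.
  - by rewrite setIACA setICr setI0.
(* The mass of [B i] is positive, so [mnormalize] conditions on this fiber instead of returning its
   default [dirac point]. *)
pose cond i : probability (borel (E * E)%type) R :=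
  mnormalize (mrestr theta (mB i)) (dirac point).
have condE i A : measurable A ->
    ((alpha i 0)%:E * cond i A = theta (A `&` B i))%E.
  move=> mA; rewrite /cond /=.
  rewrite (@mnormalizeE _ _ _ _ _ (alpha i 0))//; last first.
    by apply: (etrans _ (thetaB i)); congr (theta _); exact: setTI.
  rewrite muleA [X in (X * _)%E]muleC -muleA -EFinM divff ?gt_eqF// mule1.
  by [].
pose nus i : probability (borel E) R := distribution (cond i) second.
(* A point of [B i] is determined by its second coordinate, so gluing [nus i] back onto the fiber
   restores the conditional law. *)
have mix2 : is_mixture alpha (glued nus) theta.
  move=> C mC; rewrite thetaE//; apply: eq_bigr => i _.
  have mC' : measurable (second @^-1` (pair_left (x i) @^-1` C)).
    rewrite -[X in measurable X]setTI; apply: measurable_second => //.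
    by rewrite -[X in measurable X]setTI; exact: measurable_pair_borel.
  apply: (etrans _ (esym (condE i _ mC'))); congr (theta _).
  apply/seteqP; split => -[a b] /= [+ ax]; rewrite /B /= in ax *.
    by rewrite ax.
  by rewrite ax.
exists nus => // A mA.
apply: (etrans (esym (cpl A mA).2)); apply: (etrans (mix2 _ _)) => //.
by rewrite -[X in measurable X]setTI; exact: measurable_second.
Qed.

Variable p : R.

Definition point_cost (i : 'I_n) (z : borel E) : R := mdist (z : E) (x i) `^ p.

Lemma measurable_point_cost i : measurable_fun [set: borel E] (point_cost i).
Proof.
have := measurableT_comp (@measurable_mdist_powR R E p)
  (measurable_pair_borel (x i)).
rewrite (_ : _ \o _ = point_cost i)//.
by apply/funext => z; rewrite /point_cost metric_sym.
Qed.

Lemma glued_cost nus theta : is_mixture alpha (glued nus) theta ->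
  (\int[theta]_z (mdist (z.1 : E) z.2 `^ p)%:E =
   \sum_(i < n) (alpha i 0)%:E * \int[nus i]_z (point_cost i z)%:E)%E.
Proof.
move=> mix; rewrite (ge0_integral_mixture (fun i => ltW (alpha_gt0 i)) mix).
- apply: eq_bigr => i _; congr (_ * _)%E.
  rewrite ge0_integral_distribution//=.
  + by apply: eq_integral => z _; rewrite /point_cost metric_sym.
  + by apply/measurable_EFinP; exact: measurable_mdist_powR.
  + by move=> z; rewrite lee_fin powR_ge0.
- by apply/measurable_EFinP; exact: measurable_mdist_powR.
- by move=> z; rewrite lee_fin powR_ge0.
Qed.

(** An infinite moment of one component, weighted by [alpha i 0 > 0], would make the moment of [nu]
    infinite. *)
Lemma Pp_mixture nus : is_mixture alpha nus nu -> Pp p nu ->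
  forall i, Pp p (nus i).
Proof.
move=> mix [x0 nu_lty] i; exists x0; rewrite ltNge leye_eq; apply/negP => /eqP iy.
move: nu_lty.
have mg : measurable_fun [set: borel E]
    (fun z : borel E => (mdist (z : E) x0 `^ p)%:E).
  apply/measurable_EFinP.
  have := measurableT_comp (@measurable_mdist_powR R E p) (measurable_pair_borel x0).
  rewrite (_ : _ \o _ = fun z : borel E => mdist (z : E) x0 `^ p)//.
  by apply/funext => z /=; rewrite metric_sym.
rewrite (ge0_integral_mixture (fun i => ltW (alpha_gt0 i)) mix mg); last first.
  by move=> z; rewrite lee_fin powR_ge0.
rewrite (bigD1 i)//= iy gt0_muley ?lte_fin// addye ?ltxx//.
rewrite gt_eqF// (lt_le_trans ltNy0)//; apply: sume_ge0 => k _.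
apply: mule_ge0; first by rewrite lee_fin ltW.
by apply: integral_ge0 => z _; rewrite lee_fin powR_ge0.
Qed.

End couplings_of_discrete.

(** * Equality of the four sets of costs, and the Wasserstein distance as their minimum *)

Lemma integral_discrete (R : realType) (E : completeMetricType R) m
    (y : 'I_m -> E) (beta : 'cV[R]_m) (nu : probability (borel E) R)
    (g : borel E -> R) :
  (forall j, 0 <= beta j 0) ->
  is_mixture beta (fun j => \d_(y j : borel E)) nu ->
  measurable_fun [set: borel E] g -> (forall z, 0 <= g z) ->
  (\int[nu]_z (g z)%:E = (\sum_(j < m) beta j 0 * g (y j))%:E)%E.
Proof.
move=> beta0 mix mg g0; rewrite (ge0_integral_mixture beta0 mix).
- rewrite -sumEFin; apply: eq_bigr => j _; rewrite EFinM; congr (_ * _)%E.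
  rewrite integral_dirac//; last exact/measurable_EFinP.
  by rewrite diracT mul1e.
- exact/measurable_EFinP.
- by move=> z; rewrite lee_fin.
Qed.

Section wasserstein_minimum.
Context (R : realType) (p : R) (p_ge1 : 1 <= p) (E : completeMetricType R).
Variables (n : nat) (x : 'I_n -> E) (alpha : 'cV[R]_n).
Hypotheses (x_inj : injective x) (alpha_gt0 : forall i, 0 < alpha i 0)
  (alpha1 : \sum_(i < n) alpha i 0 = 1).
Variables (mu nu : probability (borel E) R).
Hypothesis mu_eq : is_mixture alpha (fun i => \d_(x i : borel E)) mu.

Local Notation cost := (density_cost nu alpha (point_cost x p)).

Let c0 i z : 0 <= point_cost x p i z. Proof. exact: powR_ge0. Qed.
Let mc i : measurable_fun [set: borel E] (point_cost x p i).
Proof. exact: measurable_point_cost. Qed.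

(** Both inclusions pass through mixtures. Equality of the sets of values suffices, as only their
    minima matter. *)
Lemma coupling_costs_densities :
  [set (\int[theta]_z (mdist (z.1 : E) z.2 `^ p)%:E)%E
    | theta in couplings mu nu] =
  [set cost h | h in densities nu alpha].
Proof.
apply/seteqP; split => [_ [theta cpl <-]|_ [h dh <-]] /=.
  have [nus mix glu] := mixture_of_coupling x_inj alpha_gt0 alpha1 mu_eq cpl.
  have [h dh nush] := densities_of_mixture alpha_gt0 alpha1 mix.
  exists h => //.
  by rewrite (glued_cost alpha_gt0 p glu) (mixture_cost alpha_gt0 mc c0 dh nush).
have [nus mix nush] := mixture_of_densities alpha_gt0 dh.
have [theta cpl glu] := coupling_of_mixture alpha_gt0 alpha1 mu_eq mix.
exists theta => //.
by rewrite (glued_cost alpha_gt0 p glu) (mixture_cost alpha_gt0 mc c0 dh nush).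
Qed.

(** [wasserstein] is an infimum of [p]-th roots of coupling costs. Roots are monotone, so the
    minimal density cost gives the least root, and the [p]-th power undoes the root on nonnegative
    extended reals. *)
Lemma is_min_wasserstein :
  is_min [set cost h | h in densities nu alpha] (wasserstein p mu nu `^ p)%E.
Proof.
have p0 : 0 < p by rewrite (lt_le_trans ltr01).
have [h dh hmin] := minimal_density_exists nu alpha_gt0 alpha1 mc c0.
have h0 : (0 <= cost h)%E by exact: density_cost_ge0.
have WE : wasserstein p mu nu = (cost h `^ p^-1)%E.
  have costsE := coupling_costs_densities.
  apply/eqP; rewrite eq_le; apply/andP; split.
    have [theta cpl <-] : [set (\int[theta]_z (mdist (z.1 : E) z.2 `^ p)%:E)%E
        | theta in couplings mu nu] (cost h) by rewrite costsE; exists h.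
    by apply: ereal_inf_lbound; exists theta.
  apply: le_ereal_inf_tmp => _ [theta cpl <-].
  have [g dg <-] : [set cost h | h in densities nu alpha]
      (\int[theta]_z (mdist (z.1 : E) z.2 `^ p)%:E)%E.
    by rewrite -costsE; exists theta.
  apply: gt0_ler_poweR; last exact: hmin.
  - by rewrite invr_ge0 ltW.
  - by rewrite in_itv /= h0 leey.
  - by rewrite in_itv /= (le_trans h0 (hmin _ dg)) leey.
rewrite WE -poweRrM mulVf ?gt_eqF// poweRe1//; split; first by exists h.
by move=> _ [g dg <-]; exact: hmin.
Qed.

Lemma mixture_costs_densities : Pp p nu ->
  [set (\sum_(i < n) (alpha i 0)%:E *
         \int[nus i]_z (mdist (z : E) (x i) `^ p)%:E)%E
  | nus in [set nus : 'I_n -> probability (borel E) R |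
            (forall i, Pp p (nus i)) /\ is_mixture alpha nus nu]] =
  [set cost h | h in densities nu alpha].
Proof.
move=> nuP; apply/seteqP; split => [_ [nus [_ mix] <-]|_ [h dh <-]] /=.
  have [h dh nush] := densities_of_mixture alpha_gt0 alpha1 mix.
  by exists h => //; rewrite -(mixture_cost alpha_gt0 mc c0 dh nush).
have [nus mix nush] := mixture_of_densities alpha_gt0 dh.
exists nus; first by split=> //; exact: Pp_mixture nuP.
by rewrite -(mixture_cost alpha_gt0 mc c0 dh nush).
Qed.

Lemma vector_costs_densities :
  [set (\int[nu]_z
         (\sum_(i < n) alpha i 0 * mdist (z : E) (x i) `^ p * f z i 0)%:E)%E
  | f in [set f : E -> 'cV[R]_n |
          [/\ Bplus f,
              forall z, \sum_(i < n) alpha i 0 * f z i 0 = 1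
            & forall i, (\int[nu]_z (f z i 0)%:E = 1)%E]]] =
  [set cost h | h in densities nu alpha].
Proof.
apply/seteqP; split => [_ [f [[mf f0] fs f1] <-]|_ [h [mh h0 hs h1] <-]] /=.
  exists (fun i z => f z i 0) => //; split=> //.
  exact: (proj1 (@measurable_fun_borel_cV R _ (borel E) n f) mf).
exists (fun z => \col_i h i z).
  split.
  - split; last by move=> z i; rewrite mxE.
    apply: (proj2 (@measurable_fun_borel_cV R _ (borel E) n _)) => i.
    rewrite (_ : (fun z => _) = h i); first exact: mh.
    by apply/funext => z; rewrite mxE.
  - by move=> z; rewrite -[RHS](hs z); apply: eq_bigr => i _; rewrite mxE.
  - by move=> i; rewrite -[RHS](h1 i); apply: eq_integral => z _; rewrite mxE.
apply: eq_integral => z _; congr EFin; apply: eq_bigr => i _.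
by rewrite mxE.
Qed.

(** With [A i j = h i (y j)], the pointwise constraint at the atoms of [nu] reads
    [A^T *m alpha = const_mx 1], and the normalisation of the integrals reads
    [A *m beta = const_mx 1]. *)
Lemma matrix_costs_densities m (y : 'I_m -> E) (beta : 'cV[R]_m) :
  injective y -> (forall j, 0 <= beta j 0) ->
  is_mixture beta (fun j => \d_(y j : borel E)) nu ->
  [set (\sum_(i < n) \sum_(j < m)
         alpha i 0 * A i j * beta j 0 * mdist (x i) (y j) `^ p)%:E
  | A in [set A : 'M[R]_(n, m) |
          [/\ forall i j, 0 <= A i j,
              A^T *m alpha = const_mx 1
            & A *m beta = const_mx 1]]] =
  [set cost h | h in densities nu alpha].
Proof.
move=> y_inj beta0 mix.
have costE (h : 'I_n -> borel E -> R) (A : 'M[R]_(n, m)) :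
    densities nu alpha h -> (forall i j, h i (y j) = A i j) ->
    (\sum_(i < n) \sum_(j < m)
      alpha i 0 * A i j * beta j 0 * mdist (x i) (y j) `^ p)%:E = cost h.
  move=> [mh h0 _ _] hA; rewrite /density_cost (integral_discrete beta0 mix).
  - rewrite exchange_big /=; congr EFin; apply: eq_bigr => j _.
    rewrite mulr_sumr; apply: eq_bigr => i _.
    by rewrite hA /point_cost metric_sym; ring.
  - by apply: measurable_density_integrand.
  - by move=> z; apply: density_integrand_ge0.
apply/seteqP; split => [_ [A [A0 Aalpha Abeta] <-]|_ [h dh <-]] /=; last first.
  have [mh h0 hs h1] := dh.
  exists (\matrix_(i, j) h i (y j)); last first.
    by apply: costE => // i j; rewrite mxE.
  split=> [i j||]; first by rewrite mxE.
    apply/colP => j; rewrite !mxE -[RHS](hs (y j)); apply: eq_bigr => i _.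
    by rewrite !mxE mulrC.
  apply/colP => i; rewrite !mxE; apply: EFin_inj; rewrite -[RHS](h1 i).
  rewrite (integral_discrete beta0 mix)//; congr EFin; apply: eq_bigr => j _.
  by rewrite !mxE mulrC.
(* [h i] is [A i j] at [y j] and 1 away from the atoms, where the pointwise constraint holds because
   the weights add up to 1; the indicator form makes measurability immediate. *)
pose h i (z : borel E) : R :=
  1 + \sum_(j < m) \1_([set y j] : set (borel E)) z * (A i j - 1).
have hy i j : h i (y j) = A i j.
  rewrite /h (bigD1 j)//= indicE mem_set// mul1r big1 => [|k kj].
    by rewrite addr0 addrC subrK.
  by rewrite indicE memNset ?mul0r//= => /y_inj jk; rewrite jk eqxx in kj.
have hNy i z : (forall j, z <> y j) -> h i z = 1.
  move=> zy; rewrite /h big1 ?addr0// => j _.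
  by rewrite indicE memNset ?mul0r//; exact: zy.
have y_or (z : borel E) : (exists j, z = y j) \/ (forall j, z <> y j).
  have [?|no] := pselect (exists j, z = y j); [by left|right].
  by move=> j zj; apply: no; exists j.
have mh i : measurable_fun [set: borel E] (h i).
  apply: measurable_funD => //; apply: measurable_sum => j.
  apply: measurable_funM => //; apply: measurable_indic.
  exact: measurable_set1_borel.
have h0 i z : 0 <= h i z.
  by have [[j ->]|/hNy ->//] := y_or z; rewrite hy.
have dh : densities nu alpha h.
  split=> // [z|i].
    have [[j ->]|zy] := y_or z.
      have /colP/(_ j) := Aalpha; rewrite !mxE => <-; apply: eq_bigr => i _.
      by rewrite hy !mxE mulrC.
    by rewrite -[RHS]alpha1; apply: eq_bigr => i _; rewrite hNy// mulr1.
  rewrite (integral_discrete beta0 mix)//; congr EFin.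
  have /colP/(_ i) := Abeta; rewrite !mxE => <-; apply: eq_bigr => j _.
  by rewrite hy mulrC.
by exists h => //; rewrite -(costE h A).
Qed.

End wasserstein_minimum.

Theorem proposition3p13 (R : realType) (p : R) (hp : 1 <= p)
    (E : completeMetricType R) (hE : separable E)
    (mu : probability (borel E) R) (hmu : Pp p mu)
    (n : nat) (x : 'I_n -> E) (hx : injective x)
    (alpha : 'cV[R]_n) (halpha : forall i, 0 < alpha i 0 <= 1)
    (halpha1 : \sum_(i < n) alpha i 0 = 1)
    (hmu_eq : is_mixture alpha (fun i => \d_(x i : borel E)) mu)
    (nu : probability (borel E) R) (hnu : Pp p nu) :
  [/\ is_min
        [set (\sum_(i < n) (alpha i 0)%:E *
               \int[nus i]_z (mdist (z : E) (x i) `^ p)%:E)%E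
        | nus in [set nus : 'I_n -> probability (borel E) R |
                  (forall i, Pp p (nus i)) /\ is_mixture alpha nus nu]]
        (wasserstein p mu nu `^ p)%E,
      is_min
        [set (\int[nu]_z
               (\sum_(i < n) alpha i 0 * mdist (z : E) (x i) `^ p * f z i 0)%:E)%E
        | f in [set f : E -> 'cV[R]_n |
                [/\ Bplus f,
                    forall z, \sum_(i < n) alpha i 0 * f z i 0 = 1
                  & forall i, (\int[nu]_z (f z i 0)%:E = 1)%E]]]
        (wasserstein p mu nu `^ p)%E
    & forall (m : nat) (y : 'I_m -> E) (beta : 'cV[R]_m),
        injective y ->
        (forall j, 0 < beta j 0 <= 1) ->
        \sum_(j < m) beta j 0 = 1 ->
        is_mixture beta (fun j => \d_(y j : borel E)) nu ->
        is_min
          [set (\sum_(i < n) \sum_(j < m)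
                 alpha i 0 * A i j * beta j 0 * mdist (x i) (y j) `^ p)%:E
          | A in [set A : 'M[R]_(n, m) |
                  [/\ forall i j, 0 <= A i j,
                      A^T *m alpha = const_mx 1
                    & A *m beta = const_mx 1]]]
          (wasserstein p mu nu `^ p)%E].
Proof.
have alpha_gt0 i : 0 < alpha i 0 by have /andP[] := halpha i.
split.
- rewrite (mixture_costs_densities _ alpha_gt0 halpha1 hnu).
  exact: (is_min_wasserstein hp hx alpha_gt0 halpha1 nu hmu_eq).
- rewrite (vector_costs_densities p x alpha nu).
  exact: (is_min_wasserstein hp hx alpha_gt0 halpha1 nu hmu_eq).
- move=> m y beta y_inj hbeta _ hnu_eq.
  have beta0 j : 0 <= beta j 0 by have /andP[/ltW] := hbeta j.
  rewrite (matrix_costs_densities p x alpha_gt0 halpha1 y_inj beta0 hnu_eq).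
  exact: (is_min_wasserstein hp hx alpha_gt0 halpha1 nu hmu_eq).
Qed.
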